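(* Let $\phi$ be a Boolean formula over $n$ propositional variables and let $\varepsilon,\delta\in(0,1)$. Any (possibly randomized and adaptive) algorithm that, for every such input formula $\phi$, outputs an $(\varepsilon,\delta)$-approximation of $|\mathrm{sol}(\phi)|$ using only queries to a SAT oracle in the query model described below must make $\tilde{\Omega}(\log n)$ queries to the SAT oracle. Here the tilde hides a factor of $\log\log n$, i.e. the bound is $\Omega(\log n/\log\log n)$.
   Context: For a Boolean formula $\phi$ over variables $v_1,\dots,v_n$, $\mathrm{sol}(\phi)\subseteq\{T,F\}^n$ denotes its set of satisfying assignments. An estimate $\mathsf{Est}$ is an $(\varepsilon,\delta)$-approximation of $|\mathrm{sol}(\phi)|$ if $\Pr\left[\frac{|\mathrm{sol}(\phi)|}{1+\varepsilon}\le \mathsf{Est}\le (1+\varepsilon)|\mathrm{sol}(\phi)|\right]\ge 1-\delta$. A SAT oracle takes a Boolean formula as input and returns a satisfying assignment if the formula is satisfiable, and $\bot$ otherwise. Query model (Stockmeyer's): for any set $A\subseteq\{T,F\}^n$ let $\psi_A$ be a formula with $\mathrm{sol}(\psi_A)=A$; the algorithm accesses the input $\phi$ only by querying the oracle on formulas of the form $\phi_A:=\phi\wedge\psi_A$ for arbitrary (adaptively chosen) sets $A$. *)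

(* Defs.v *)
From HB Require Import structures.
From mathcomp Require Import all_boot all_order all_algebra.
From mathcomp Require Import all_classical all_reals all_analysis.

Set Implicit Arguments.
Unset Strict Implicit.
Unset Printing Implicit Defensive.

Import Order.TTheory GRing.Theory Num.Theory.
Local Open Scope ring_scope.

Definition assignment (n : nat) := {ffun 'I_n -> bool}.

Inductive formula (n : nat) : Type :=
| FTrue
| FVar of 'I_n
| FNot of formula n
| FAnd of formula n & formula n
| FOr of formula n & formula n.
Arguments FTrue {n}.

Fixpoint feval (n : nat) (s : assignment n) (phi : formula n) : bool :=
  match phi with
  | FTrue => true
  | FVar i => s i
  | FNot f => ~~ feval s f
  | FAnd f g => feval s f && feval s g
  | FOr f g => feval s f || feval s g
  end.

Definition sol (n : nat) (phi : formula n) : {set assignment n} :=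
  [set s : assignment n | feval s phi]%SET.

(* [None] is the answer "unsatisfiable". *)
Definition sat_oracle (n : nat) (O : formula n -> option (assignment n)) : Prop :=
  forall f : formula n,
    match O f with
    | Some s => is_true (s \in sol f)
    | None => sol f = finset.set0
    end.

Definition defines_sets (n : nat) (psi : {set assignment n} -> formula n) : Prop :=
  forall A : {set assignment n}, sol (psi A) = A.

Lemma defines_sets_ex (n : nat) :
  exists psi : {set assignment n} -> formula n, defines_sets psi.
Proof.
pose lit (a : assignment n) i := if a i then FVar i else FNot (FVar i).
pose cube a := foldr (fun i f => FAnd (lit a i) f) FTrue (enum 'I_n).
pose dnf (A : {set assignment n}) :=
  foldr (fun a f => FOr (cube a) f) (FNot FTrue) (enum A).
have cubeE a s : feval s (cube a) = (s == a).
  have -> : feval s (cube a) = all (fun i => s i == a i) (enum 'I_n).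
    rewrite /cube; elim: (enum 'I_n) => //= i r ->.
    by congr (_ && _); rewrite /lit; case: (a i) => /=; case: (s i).
  apply/allP/eqP => [sa|-> //].
  by apply/ffunP => i; apply/eqP/sa; rewrite mem_enum.
exists dnf => A; apply/finset.setP => s; rewrite inE -(mem_enum A) /dnf.
by elim: (enum A) => //= a r ->; rewrite cubeE inE.
Qed.

(* A deterministic adaptive algorithm. [Query A k] asks the oracle about
   phi /\ psi_A and continues with [k] applied to the answer; the input formula
   itself does not occur in the tree. *)
Inductive algorithm (n : nat) (E : Type) : Type :=
| Output of E
| Query of {set assignment n} & (option (assignment n) -> algorithm n E).

Section Run.
Variables (n : nat) (E : Type).
Variables (psi : {set assignment n} -> formula n).
Variables (O : formula n -> option (assignment n)) (phi : formula n).

Fixpoint estimate (a : algorithm n E) : E :=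
  match a with
  | Output e => e
  | Query A k => estimate (k (O (FAnd phi (psi A))))
  end.

Fixpoint num_queries (a : algorithm n E) : nat :=
  match a with
  | Output _ => 0%N
  | Query A k => (num_queries (k (O (FAnd phi (psi A))))).+1
  end.

End Run.

Section Approximation.
Context {R : realType} {d : measure_display} {T : measurableType d}.
Variable P : probability T R.

Definition approximates (eps delta : R) (n : nat) (phi : formula n)
    (Est : T -> R) : Prop :=
  let s : R := #|sol phi|%:R in
  ((1 - delta)%:E <=
     P [set w | (s / (1 + eps) <= Est w <= (1 + eps) * s)%R]%classic)%E.

(* A randomized algorithm is a random deterministic one: all internal coins are
   collected in the sample point [w : T]. *)
Definition randomized_counter (eps delta : R) (n : nat)
    (psi : {set assignment n} -> formula n) (alg : T -> algorithm n R) : Prop :=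
  forall (phi : formula n) (O : formula n -> option (assignment n)),
    sat_oracle O ->
    measurable_fun setT (fun w => estimate psi O phi (alg w)) /\
    approximates eps delta phi (fun w => estimate psi O phi (alg w)).

Definition makes_at_most (q : nat) (n : nat)
    (psi : {set assignment n} -> formula n) (alg : T -> algorithm n R) : Prop :=
  forall (phi : formula n) (O : formula n -> option (assignment n)),
    sat_oracle O ->
    {ae P, forall w, (num_queries psi O phi (alg w) <= q)%N}.

End Approximation.

(* Main.v *)
(* Order the assignments, let the oracle answer with the first satisfying
   assignment, and take as inputs the formulas phi_j whose solutions are the
   first b^j assignments, where b > (1 + eps)^2.  On phi_j /\ psi_A the answer
   is either "unsatisfiable" or the first element of A, which does not depend
   on j.  So, for fixed coins, the runs on all the phi_j follow a binary tree
   with at most 2^q leaves.  By the choice of b, the output at a leaf is a valid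
   estimate for at most one j, hence fixed coins succeed on at most 2^q inputs.
   Averaging over the coins, (1 - delta) times the number of inputs is at most
   2^q; for b = 4 there are more than n / 2 inputs. *)

Require Import Defs.
From HB Require Import structures.
From mathcomp Require Import all_boot all_order all_algebra.
From mathcomp Require Import all_classical all_reals all_analysis.
From mathcomp Require Import measurable_realfun lra.

Set Implicit Arguments.
Unset Strict Implicit.
Unset Printing Implicit Defensive.

Import Order.TTheory GRing.Theory Num.Theory.
Local Open Scope ring_scope.

Section DecisionTree.
Variables (n : nat) (E : Type) (psi : {set assignment n} -> formula n).
Variables (O : formula n -> option (assignment n)).
Variables (I : finType) (phi : I -> formula n) (b : nat).
Hypothesis b_gt0 : (0 < b)%N.
Hypothesis card_answers : forall A : {set assignment n},
  (#|[set O (FAnd (phi i) (psi A)) | i : I]%SET| <= b)%N.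

Lemma card_injective_estimates (a : algorithm n E) (q : nat) (J : {set I}) :
  {in J, forall i, (num_queries psi O (phi i) a <= q)%N} ->
  {in J &, injective (fun i => estimate psi O (phi i) a)} ->
  (#|J| <= b ^ q)%N.
Proof.
elim: a q J => [e|A k IHk] q J few inj.
  apply: (@leq_trans 1); last by rewrite expn_gt0 b_gt0.
  by apply/card_le1_eqP => i j Ji Jj; apply: inj.
case: q few => [few|q few].
  rewrite leqNgt; apply/negP => /ltnW/card_gt0P[i Ji].
  by have := few i Ji.
pose answer i := O (FAnd (phi i) (psi A)).
have card_fiber x : (#|[set i in J | answer i == x]%SET| <= b ^ q)%N.
  apply: (IHk x) => [i|i j].
    by rewrite inE => /andP[Ji /eqP <-]; exact: few.
  rewrite !inE => /andP[Ji /eqP ansi] /andP[Jj /eqP ansj] eq_est.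
  by apply: inj => //=; rewrite -/(answer i) -/(answer j) ansi ansj.
rewrite -sum1_card (partition_big_imset answer) expnS /=.
apply: (@leq_trans (#|answer @: J| * b ^ q)).
  rewrite -sum_nat_const; apply: leq_sum => x _.
  by rewrite sum1_card -cardsE; exact: card_fiber.
apply: leq_mul => //; apply: leq_trans (card_answers A).
by apply/subset_leq_card/imsetS/fintype.subsetP.
Qed.

End DecisionTree.

Definition initial_segment (T : finType) (m : nat) : {set T} :=
  [set x in take m (enum T)]%SET.

Lemma card_initial_segment (T : finType) (m : nat) :
  #|initial_segment T m| = minn m #|T|.
Proof.
by rewrite cardsE (card_uniqP _) ?take_uniq ?enum_uniq// size_take_min -cardE.
Qed.

Lemma filter_initial_segment (T : finType) (m : nat) :
  [seq x <- enum T | x \in initial_segment T m] = take m (enum T).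
Proof.
rewrite (eq_filter (a2 := mem (take m (enum T)))) => [|x]; last by rewrite !inE.
by apply/esym/subseq_uniqP; rewrite ?enum_uniq ?take_subseq.
Qed.

Lemma ohead_filter_take (T : Type) (p : pred T) (m : nat) (s : seq T) :
  ohead [seq x <- take m s | p x] = None \/
  ohead [seq x <- take m s | p x] = ohead [seq x <- s | p x].
Proof.
rewrite -[in X in _ \/ _ = X](cat_take_drop m s) filter_cat.
by case: [seq x <- take m s | p x] => [|x r]; [left|right].
Qed.

Definition first_oracle {n : nat} (f : formula n) : option (assignment n) :=
  ohead [seq s <- enum {: assignment n} | feval s f].

Lemma first_oracle_sat (n : nat) : sat_oracle (@first_oracle n).
Proof.
move=> f; rewrite /first_oracle.
have: [seq s <- enum {: assignment n} | feval s f] =i sol f.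
  by move=> s; rewrite mem_filter mem_enum !inE andbT.
case: [seq s <- _ | feval s f] => [|s r] /= sols.
  by apply/finset.setP => s; rewrite -sols finset.in_set0.
by rewrite -sols mem_head.
Qed.

Lemma first_oracle_FAnd (n m : nat) (phi f : formula n) :
  sol phi = initial_segment _ m ->
  first_oracle (FAnd phi f) = None \/
  first_oracle (FAnd phi f) = first_oracle f.
Proof.
move=> sol_phi; rewrite /first_oracle.
have -> : [seq s <- enum {: assignment n} | feval s (FAnd phi f)] =
          [seq s <- take m (enum {: assignment n}) | feval s f].
  rewrite -filter_initial_segment -sol_phi -[RHS]filter_predI.
  by apply: eq_filter => s /=; rewrite inE andbC.
exact: ohead_filter_take.
Qed.

Lemma card_first_oracle_answers (n : nat) (I : finType) (phi : I -> formula n)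
    (f : formula n) :
  (forall i, exists m, sol (phi i) = initial_segment _ m) ->
  (#|[set first_oracle (FAnd (phi i) f) | i : I]%SET| <= 2)%N.
Proof.
move=> segments.
apply: leq_trans (_ : #|[set None; first_oracle f]%SET| <= _)%N.
  apply/subset_leq_card/fintype.subsetP => _ /imsetP[i _ ->]; rewrite !inE.
  have [m sol_phi] := segments i.
  by case: (first_oracle_FAnd f sol_phi) => ->; rewrite eqxx ?orbT.
by rewrite cards2; case: eqP.
Qed.

Definition within_factor (R : realFieldType) (c x e : R) : bool :=
  x / c <= e <= c * x.

Lemma within_factor_ratio (R : realFieldType) (c x y e : R) :
  0 < c -> within_factor c x e -> within_factor c y e -> y <= c ^+ 2 * x.
Proof.
move=> c_gt0 /andP[_ e_le] /andP[y_le _].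
by rewrite expr2 -mulrA [c * _]mulrC -ler_pdivrMr// (le_trans y_le e_le).
Qed.

Lemma within_factor_expr_inj (R : realFieldType) (c r e : R) (i j : nat) :
  1 <= c -> c ^+ 2 < r ->
  within_factor c (r ^+ i) e -> within_factor c (r ^+ j) e -> i = j.
Proof.
move=> c_ge1 lt_r.
have c_gt0 : 0 < c by exact: lt_le_trans c_ge1.
have r_gt1 : 1 < r by apply: le_lt_trans lt_r; exact: exprn_ege1.
have r_gt0 : 0 < r by exact: lt_trans r_gt1.
have not_lt k l : within_factor c (r ^+ k) e -> within_factor c (r ^+ l) e ->
    ~~ (k < l)%N.
  move=> ck cl; rewrite -leqNgt -ltnS -(ltr_eXn2l r_gt1).
  apply: (le_lt_trans (within_factor_ratio c_gt0 ck cl)).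
  by rewrite [ltRHS]exprS ltr_pM2r ?exprn_gt0.
move=> ci cj; apply/eqP.
by case: ltngtP (not_lt _ _ ci cj) (not_lt _ _ cj ci).
Qed.

Lemma sum_measure_le_overlap (R : realType) (d : measure_display)
    (T : measurableType d) (mu : {measure set T -> \bar R}) (I : finType)
    (B : I -> set T) (K : nat) :
  (forall i, measurable (B i)) ->
  {ae mu, forall x, (#|[set i | x \in B i]%SET| <= K)%N} ->
  (\sum_i mu (B i) <= K%:R%:E * mu setT)%E.
Proof.
move=> mB overlap.
have mindic i : measurable_fun setT (EFin \o (\1_(B i) : T -> R)).
  by apply/measurable_EFinP; exact: measurable_indic.
have -> : (\sum_i mu (B i) = \int[mu]_x \sum_i (\1_(B i) x)%:E)%E.
  rewrite ge0_integral_sum//.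
  by apply: eq_bigr => i _; rewrite integral_indic// setIT.
rewrite -integral_cst//; apply: ae_ge0_le_integral => //.
- by move=> x _; apply: sume_ge0 => i _; rewrite lee_fin.
- exact: emeasurable_sum.
- by move=> x _; rewrite lee_fin.
apply: filterS overlap => x overlap_x _ /=.
rewrite sumEFin lee_fin (eq_bigr (fun i => (x \in B i)%:R)) => [|i _].
  by rewrite -natr_sum ler_nat -big_mkcond sum1_card -cardsE.
by rewrite indicE.
Qed.

Section HardFormulas.
Variables (n : nat) (psi : {set assignment n} -> formula n).
Hypothesis psiP : defines_sets psi.
Variables (b m : nat).
Hypothesis le_bm : (b ^ m <= 2 ^ n)%N.

Definition hard_formula (j : 'I_m.+1) : formula n :=
  psi (initial_segment _ (b ^ j)).

Lemma card_sol_hard_formula (j : 'I_m.+1) :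
  (0 < b)%N -> #|sol (hard_formula j)| = (b ^ j)%N.
Proof.
move=> b_gt0; rewrite psiP card_initial_segment card_ffun card_bool card_ord.
apply/minn_idPl; apply: leq_trans le_bm.
by apply: leq_pexp2l; rewrite // -ltnS.
Qed.

Variables (R : realType) (eps delta : R).
Hypotheses (eps_ge0 : 0 <= eps) (lt_b : (1 + eps) ^+ 2 < b%:R).

Let b_gt0 : (0 < b)%N.
Proof. by rewrite -(ltr_nat R); exact: le_lt_trans (sqr_ge0 _) lt_b. Qed.

Lemma card_approximated_hard_formulas (a : algorithm n R) (q : nat) :
  (forall j, num_queries psi first_oracle (hard_formula j) a <= q)%N ->
  (#|[set j | within_factor (1 + eps) #|sol (hard_formula j)|%:R
        (estimate psi first_oracle (hard_formula j) a)]%SET| <= 2 ^ q)%N.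
Proof.
move=> few; apply: card_injective_estimates => [//|A|j _|i j].
- by apply: card_first_oracle_answers => j; exists (b ^ j)%N; exact: psiP.
- exact: few.
rewrite !inE !card_sol_hard_formula// !natrX => approx_i + eq_est.
rewrite -eq_est => approx_j; apply: val_inj.
by apply: within_factor_expr_inj lt_b approx_i approx_j; rewrite lerDl.
Qed.

Lemma inputs_le_pow2_queries (d : measure_display) (T : measurableType d)
    (P : probability T R) (alg : T -> algorithm n R) (q : nat) :
  randomized_counter P eps delta psi alg -> makes_at_most P q psi alg ->
  (1 - delta) * m.+1%:R <= 2 ^+ q.
Proof.
move=> counter queries.
pose est j w := estimate psi first_oracle (hard_formula j) (alg w).
pose target j : R := #|sol (hard_formula j)|%:R.
pose success j :=
  [set w | within_factor (1 + eps) (target j) (est j w)]%classic.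
have msuccess j : measurable (success j).
  have [mest _] := counter (hard_formula j) _ (@first_oracle_sat n).
  have -> : (success j = setT `&` est j @^-1`
      `[target j / (1 + eps), (1 + eps) * target j])%classic.
    by rewrite setTI; apply/seteqP; split=> w; rewrite /success /= in_itv.
  exact: mest.
have Psuccess j : ((1 - delta)%:E <= P (success j))%E.
  by have [] := counter (hard_formula j) _ (@first_oracle_sat n).
have few_successes :
    {ae P, forall w, (#|[set j | w \in success j]%SET| <= 2 ^ q)%N}.
  have few_queries : {ae P, forall w, forall j,
      (num_queries psi first_oracle (hard_formula j) (alg w) <= q)%N}.
    by apply: filter_forall => j; apply: queries; exact: first_oracle_sat.
  apply: filterS few_queries => w few.
  under eq_finset => j do rewrite [_ \in _]asboolb.
  exact: card_approximated_hard_formulas.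
have sum_le : (\sum_j P (success j) <= (2 ^ q)%N%:R%:E)%E.
  rewrite -[leRHS]mule1 -(probability_setT P).
  exact: sum_measure_le_overlap.
have le_sum : (\sum_(j < m.+1) (1 - delta)%:E <= \sum_j P (success j))%E.
  by apply: lee_sum => j _; exact: Psuccess.
have := le_trans le_sum sum_le.
by rewrite sumEFin lee_fin natrX sumr_const card_ord mulr_natr.
Qed.

End HardFormulas.

Lemma le_pow2_ln (R : realType) (x : R) (q : nat) :
  0 < x -> x <= 2 ^+ q -> ln x <= q%:R.
Proof.
move=> x_gt0 le_x; apply: (@le_trans _ _ (ln (2 ^+ q))).
  by rewrite ler_ln ?posrE ?exprn_gt0.
rewrite lnXn// -[leLHS]mulr_natr ler_piMl//.
exact: le_ln1Dx.
Qed.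

Lemma near_ln_ge (R : realType) (M : R) :
  \forall n \near \oo%classic, M <= ln n%:R.
Proof.
apply: filterS (nbhs_infty_ger (expR M)) => n leMn.
by rewrite -ler_expR lnK// posrE (lt_le_trans (expR_gt0 M)).
Qed.

Lemma ln_div_lnln_le_pow2 (R : realType) (k : R) : 0 < k ->
  \forall n \near \oo%classic, forall q : nat,
    k * n%:R <= 2 ^+ q -> ln (n%:R : R) / ln (ln (n%:R : R)) <= q%:R.
Proof.
move=> k_gt0; near=> n => q le_kn.
have n_gt0 : 0 < n%:R :> R by near: n; exact: nbhs_infty_gtr.
have lnn_ge : expR 2 <= ln n%:R :> R by near: n; exact: near_ln_ge.
have lnk_le : - (2 * ln k) <= ln n%:R by near: n; exact: near_ln_ge.
have lnn_gt0 : 0 < ln n%:R :> R by exact: lt_le_trans (expR_gt0 2) lnn_ge.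
have lnln_ge2 : 2 <= ln (ln n%:R) :> R by rewrite -ler_expR lnK.
have le_q : ln k + ln n%:R <= q%:R.
  by rewrite -lnM// le_pow2_ln// mulr_gt0.
rewrite ler_pdivrMr; last by lra.
have : q%:R * 2 <= q%:R * ln (ln n%:R) :> R by rewrite ler_wpM2l.
by lra.
Unshelve. all: by end_near. Qed.

Theorem theorem1 (R : realType) (eps delta : R)
    (heps : 0 < eps < 1) (hdelta : 0 < delta < 1) :
  exists2 c : R, 0 < c &
  exists N : nat, forall n : nat, (N <= n)%N ->
  forall psi : {set assignment n} -> formula n, defines_sets psi ->
  forall (d : measure_display) (T : measurableType d) (P : probability T R)
    (alg : T -> algorithm n R) (q : nat),
    randomized_counter P eps delta psi alg ->
    makes_at_most P q psi alg ->
    c * (ln (n%:R : R) / ln (ln (n%:R : R))) <= q%:R.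
Proof.
have [[eps_gt0 eps_lt1] [_ delta_lt1]] := (andP heps, andP hdelta).
have k_gt0 : 0 < (1 - delta) / 2 by lra.
exists 1 => //; have [N _ le_q] := ln_div_lnln_le_pow2 k_gt0.
exists N => n leNn psi psiP d T P alg q counter queries.
rewrite mul1r; apply: (le_q n leNn).
have pow4_le : (4 ^ n./2 <= 2 ^ n)%N.
  by rewrite -[4%N]/(2 ^ 2)%N -expnM leq_exp2l// mul2n -geq_half_double.
have lt4 : (1 + eps) ^+ 2 < 4 by rewrite expr2; nra.
apply: le_trans
  (inputs_le_pow2_queries psiP pow4_le (ltW eps_gt0) lt4 counter queries).
have half_le : n%:R <= 2 * n./2.+1%:R :> R.
  by rewrite -natrM ler_nat mul2n ltnW// -ltn_half_double.
by rewrite -mulrA; apply: ler_wpM2l; lra.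
Qed.
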